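(* Let $k$ be a field, $n\in\mathbb{N}\setminus\{0\}$, and let $s=\sum_{g\in\mathbb{Z}^n}s_g\underline{x}^g\in k((\underline{x}))$. Then $s\in k(\underline{x})$ if and only if the following holds: there exist $\ell\in\mathbb{N}$, a finite set $A=\{h_0,\ldots,h_\ell\}\subseteq\mathbb{Z}^n$ with $h_0<_{\mathrm{lex}}\ldots<_{\mathrm{lex}}h_\ell$, and elements $r_0,\ldots,r_\ell\in k$, not all equal to $0$, such that for any $g\in\mathbb{Z}^n\setminus A$ $$\sum_{j=0}^\ell r_js_{g-h_j}=0.$$
   Context: $\mathbb{N}$ includes $0$. $\mathbb{Z}^n$ is an ordered abelian group under the lexicographic ordering $<_{\mathrm{lex}}$. $k((\mathbb{Z}^n))$ is the field of generalised power series: all functions $s\colon\mathbb{Z}^n\to k$, written $s=\sum_{g}s_gt^g$, with well-ordered (for $<_{\mathrm{lex}}$) support $\{g\mid s_g\neq 0\}$, with pointwise addition and convolution product $sp=\sum_{g}\left(\sum_{h}s_hp_{g-h}\right)t^g$. Write $\underline{x}=(x_1,\ldots,x_n)$ and $\underline{x}^g=x_1^{g_1}\cdots x_n^{g_n}$. $k(\underline{x})$ is the fraction field of $k[\underline{x}]$ and $k((\underline{x}))$ is the fraction field of the formal power series ring $k[[\underline{x}]]$. Since $\mathbb{N}^n$ is well-ordered by $<_{\mathrm{lex}}$, the map $\sum_{g\in\mathbb{N}^n}s_g\underline{x}^g\mapsto\sum_{g\in\mathbb{N}^n}s_gt^g$ embeds $k[[\underline{x}]]$ in $k((\mathbb{Z}^n))$;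 this extends to an embedding of $k((\underline{x}))$ in $k((\mathbb{Z}^n))$, and via it each element of $k((\underline{x}))$ is expanded uniquely as $\sum_{g\in\mathbb{Z}^n}s_g\underline{x}^g$, where $\sum_{g}s_gt^g$ is its image in $k((\mathbb{Z}^n))$. *)

(* Defs.v *)
From HB Require Import structures.
From mathcomp Require Import all_boot all_order all_algebra.
From mathcomp Require Import boolp classical_sets functions cardinality fsbigop.
From mathcomp Require Import wochoice.
From mathcomp Require Import finmap mpoly.

Set Implicit Arguments.
Unset Strict Implicit.
Unset Printing Implicit Defensive.

Import Order.TTheory GRing.Theory Num.Theory.
Local Open Scope classical_set_scope.
Local Open Scope ring_scope.

(* Z^n with the library's lexicographic order on n-tuples, transported to
   {ffun 'I_n -> int}, which has the group structure; see [ltlexP]. *)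
Definition Zlex (n : nat) := {ffun 'I_n -> int}.

HB.instance Definition _ n :=
  GRing.Zmodule.copy (Zlex n) {ffun 'I_n -> int}.

Definition Zlex_tuple n (g : Zlex n) : n.-tuplelexi int := [tuple g i | i < n].
Definition Zlex_of_tuple n (t : n.-tuplelexi int) : Zlex n :=
  [ffun i => tnth t i].

Lemma Zlex_tupleK n : cancel (@Zlex_tuple n) (@Zlex_of_tuple n).
Proof. by move=> g; apply/ffunP => i; rewrite ffunE tnth_mktuple. Qed.

Fact lex_display : Order.disp_t. Proof. by []. Qed.

Section ZlexOrder.
Variable n : nat.
Implicit Types g h : Zlex n.

Let le g h := (Zlex_tuple g <= Zlex_tuple h)%O.
Let lt g h := (Zlex_tuple g < Zlex_tuple h)%O.

Fact Zlex_lt_def g h : lt g h = (h != g) && le g h.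
Proof.
by rewrite /lt /le lt_neqAle eq_sym (inj_eq (can_inj (@Zlex_tupleK n))).
Qed.

Fact Zlex_le_refl : reflexive le. Proof. by move=> g; apply: lexx. Qed.

Fact Zlex_le_anti : antisymmetric le.
Proof. by move=> g h /le_anti/(can_inj (@Zlex_tupleK n)). Qed.

Fact Zlex_le_trans : transitive le.
Proof. by move=> g h a; apply: le_trans. Qed.

HB.instance Definition _ := Order.isPOrder.Build lex_display (Zlex n)
  Zlex_lt_def Zlex_le_refl Zlex_le_anti Zlex_le_trans.

Fact Zlex_le_total : total (<=%O : rel (Zlex n)).
Proof. by move=> g h; apply: (le_total (Zlex_tuple g)). Qed.

HB.instance Definition _ :=
  Order.POrder_isTotal.Build lex_display (Zlex n) Zlex_le_total.

End ZlexOrder.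

Notation "x <=lex y" := (@Order.le lex_display _ x y)
  (at level 70, no associativity) : ring_scope.
Notation "x <lex y" := (@Order.lt lex_display _ x y)
  (at level 70, no associativity) : ring_scope.

Section LexOrder.
Variable n : nat.
Implicit Types (g h a : Zlex n) (S P B : set (Zlex n)).

Lemma ltlexP g h :
  reflect (exists2 i : 'I_n, (forall j : 'I_n, (j < i)%N -> g j = h j)
                           & g i < h i)
          (g <lex h).
Proof.
have -> : (g <lex h) = (Zlex_tuple g < Zlex_tuple h)%O by [].
apply: (iffP ltxi_tuplePlt) => -[i eqi lti]; exists i.
- by move=> j /eqi; rewrite !tnth_mktuple.
- by move: lti; rewrite !tnth_mktuple.
- by move=> j /eqi; rewrite !tnth_mktuple.
- by rewrite !tnth_mktuple.
Qed.

Lemma ltlexD2l a g h : (a + g <lex a + h) = (g <lex h).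
Proof.
apply/ltlexP/ltlexP => -[i eqi lti]; exists i.
- by move=> j /eqi; rewrite !ffunE => /addrI.
- by move: lti; rewrite !ffunE ltrD2l.
- by move=> j /eqi; rewrite !ffunE => ->.
- by rewrite !ffunE ltrD2l.
Qed.

Lemma lelexD2l a g h : (a + g <=lex a + h) = (g <=lex h).
Proof. by rewrite !leNgt ltlexD2l. Qed.

(* [wo_chain] restated for sets ([wo_chainP]), for the proofs below. *)
Definition wo S := forall B, (forall g, B g -> S g) -> (exists g, B g) ->
  exists2 m, B m & forall g, B g -> m <=lex g.

Lemma wo_chainP (D : {pred Zlex n}) :
  wo_chain (fun g h : Zlex n => g <=lex h) D <-> wo [set g | g \in D].
Proof.
split=> woD.
  move=> B sBD [z Bz].
  have [||m [[Bm lem] _]] := woD [pred g | `[< B g >]].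
  - by move=> g; rewrite !inE => /asboolP/sBD.
  - by exists z; rewrite inE; apply/asboolP.
  exists m; first by move: Bm; rewrite inE => /asboolP.
  by move=> g Bg; apply: lem; rewrite inE; apply/asboolP.
move=> A sAD [z Az].
have [||m Am lem] := woD [set g | g \in A]; [by move=> g /sAD|by exists z|].
exists m; split; first by split=> // g; apply: lem.
by move=> m' [Am' lem']; apply/eqP; rewrite eq_le lem ?lem'.
Qed.

Lemma wo_sub S P : (forall g, S g -> P g) -> wo P -> wo S.
Proof. by move=> sSP woP B sBS; apply: woP => g /sBS/sSP. Qed.

Lemma wo_ind S (Q : Zlex n -> Prop) : wo S ->
  (forall x, S x -> (forall y, S y -> y <lex x -> Q y) -> Q x) ->
  forall x, S x -> Q x.
Proof.
move=> woS IH x Sx; apply: contrapT => nQx.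
have [|| m [Sm nQm] lem] := woS [set y | S y /\ ~ Q y].
- by move=> ? [].
- by exists x.
apply: nQm; apply: IH => // y Sy ltym; apply: contrapT => nQy.
by have := lem y (conj Sy nQy); rewrite leNgt ltym.
Qed.

Lemma wo0 : wo [set 0].
Proof. by move=> B sB0 [g Bg]; exists g => // h /sB0 ->; rewrite (sB0 _ Bg). Qed.

Lemma woU S P : wo S -> wo P -> wo (S `|` P).
Proof.
move=> woS woP B sB [g Bg].
have [eS|nS] := pselect (exists g, B g /\ S g); last first.
  apply: woP; last by exists g.
  by move=> h Bh; case: (sB _ Bh) => // Sh; case: nS; exists h.
have [eP|nP] := pselect (exists g, B g /\ P g); last first.
  apply: woS; last by exists g.
  by move=> h Bh; case: (sB _ Bh) => // Ph; case: nP; exists h.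
have [|//|m [Bm Sm] lem] := woS (B `&` S); first by move=> ? [].
have [|//|m' [Bm' Pm'] lem'] := woP (B `&` P); first by move=> ? [].
have [lemm|/ltW lemm] := leP m m'.
  exists m => // h Bh; case: (sB _ Bh) => [Sh|Ph]; first exact: lem.
  exact: le_trans lemm (lem' _ _).
exists m' => // h Bh; case: (sB _ Bh) => [Sh|Ph]; last exact: lem'.
exact: le_trans lemm (lem _ _).
Qed.

Definition addset S P : set (Zlex n) :=
  [set g | exists a b, [/\ S a, P b & g = a + b]].

Lemma wo_add S P : wo S -> wo P -> wo (addset S P).
Proof.
move=> woS woP B sB [g0 Bg0].
pose B_ (D : set (Zlex n)) : set (Zlex n) :=
  [set g | B g /\ exists a b, [/\ S a, D a, P b & g = a + b]].
pose good D := (exists g, B_ D g) -> exists2 m, B_ D m & forall g, B_ D g -> m <=lex g.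
have step D : (forall x y, D x -> y <lex x -> D y) ->
  (forall x, S x -> D x -> good [set y | y <lex x]) -> good D.
  move=> Dd IH [g Bg].
  have [||p [a [Sa Da Pp Bap]] lep] :=
    woP [set p | exists a, [/\ S a, D a, P p & B (a + p)]].
  - by move=> p [a []].
  - by case: Bg => Bg [a [b [Sa Da Pb gE]]]; exists b, a; rewrite -gE.
  have main m : B m -> m <=lex a + p ->
      (forall h, B_ [set y | y <lex a] h -> m <=lex h) ->
      forall h, B_ D h -> m <=lex h.
    move=> Bm lem1 lem2 h [Bh [x [q [Sx Dx Pq hE]]]].
    have [ltxa|leax] := ltP x a.
      by apply: lem2; split=> //; exists x, q.
    apply: le_trans lem1 _; rewrite hE.
    apply: le_trans (_ : a + q <=lex x + q).
      by rewrite lelexD2l; apply: lep; exists x; split=> //; rewrite -hE.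
    by rewrite ![_ + q]addrC lelexD2l.
  have BD : B_ D (a + p) by split=> //; exists a, p.
  have [e|ne] := pselect (exists g, B_ [set y | y <lex a] g); last first.
    exists (a + p) => // h Bh; apply: main Bh => // h' Bh'.
    by case: ne; exists h'.
  have [m [Bm [x [q [Sx ltx Pq mE]]]] lem] := IH a Sa Da e.
  have [lemm|/ltW lemm] := leP m (a + p).
    exists m; first by split=> //; exists x, q; split=> //; apply: Dd Da _.
    exact: main.
  exists (a + p) => //; apply: main => // h /lem.
  exact: le_trans.
have goodlt x : S x -> good [set y | y <lex x].
  move: x; apply: (wo_ind woS) => x Sx IH.
  by apply: step => [y z ltyx /lt_trans|y Sy ltyx]; [apply|apply: IH].
have [|||m [Bm _] lem] := step setT.
- by [].
- by move=> x Sx _; apply: goodlt.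
- by exists g0; split=> //; have [a [b [Sa Pb]]] := sB _ Bg0; exists a, b.
exists m => // h Bh; apply: lem; split=> //.
by have [a [b [Sa Pb]]] := sB _ Bh; exists a, b.
Qed.

Lemma wo_rev_finite S : wo S ->
  (forall B, (forall g, B g -> S g) -> (exists g, B g) ->
     exists2 m, B m & forall g, B g -> g <=lex m) -> finite_set S.
Proof.
move=> woS rwo.
have [[g Sg]|nS] := pselect (exists g, S g); last first.
  have -> : S = set0 by apply/seteqP; split=> // x Sx; apply: nS; exists x.
  exact: finite_set0.
suff fin x : S x -> finite_set [set y | S y /\ y <=lex x].
  have [//||m Sm lem] := rwo S; first by exists g.
  by apply: sub_finite_set (fin m Sm) => y Sy; split=> //; apply: lem.
move: x; apply: (wo_ind woS) => x Sx IH.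
have [e|ne] := pselect (exists y, S y /\ y <lex x); last first.
  apply: sub_finite_set (finite_set1 x) => y [Sy leyx] /=.
  apply/eqP; rewrite eq_le leyx leNgt; apply/negP => ltyx.
  by apply: ne; exists y.
have [|//|m [Sm ltmx] lem] := rwo [set y | S y /\ y <lex x].
  by move=> ? [].
apply: (@sub_finite_set _ _ ([set y | S y /\ y <=lex m] `|` [set x])).
  move=> y [Sy]; rewrite le_eqVlt => /orP[/eqP ->|ltyx]; first by right.
  by left; split=> //; apply: lem.
by rewrite finite_setU; split; [apply: IH|apply: finite_set1].
Qed.

Lemma conv_finite S P g : wo S -> wo P ->
  finite_set [set h | S h /\ P (g - h)].
Proof.
move=> woS woP; apply: wo_rev_finite; first by apply: wo_sub woS => ? [].
move=> B sB [b Bb].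
have [||p Bp lep] := woP [set p | B (g - p)].
- by move=> p /sB[_]; rewrite opprB addrCA subrr addr0.
- by exists (g - b); rewrite /= opprB addrCA subrr addr0.
exists (g - p) => // h Bh.
have /lep : [set p | B (g - p)] (g - h).
  by rewrite /= opprB addrCA subrr addr0.
by rewrite -(lelexD2l (h - p)) addrNK [X in _ <=lex X]addrC addrA addrNK.
Qed.


(* The submonoid generated by P. *)
Inductive mon P : Zlex n -> Prop :=
| mon0 : mon P 0
| monD a b : P a -> mon P b -> mon P (a + b).

Lemma wo_slices (i : nat) (ltin : (i < n)%N) S :
  (forall g h, S g -> S h -> forall j : 'I_n, (j < i)%N -> g j = h j) ->
  (forall g, S g -> 0 <= g (Ordinal ltin)) ->
  (forall c : nat, wo [set g | S g /\ g (Ordinal ltin) = c%:Z]) -> wo S.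
Proof.
move=> eqS posS woS B sB [g0 Bg0]; set k := Ordinal ltin in posS woS *.
have ex : exists c : nat, `[< exists2 g, B g & g k = c%:Z >].
  exists `|g0 k|%N; apply/asboolP; exists g0 => //.
  by rewrite gez0_abs // posS //; apply: sB.
case: (ex_minnP ex) => c /asboolP[b Bb bc] minc.
have [||m [Bm mc] lem] := woS c [set g | B g /\ g k = c%:Z].
- by move=> g [Bg gc]; split=> //; apply: sB.
- by exists b.
exists m => // g Bg.
have [d gd] : exists d : nat, g k = d%:Z.
  by exists `|g k|%N; rewrite gez0_abs // posS //; apply: sB.
have : (c <= d)%N by apply: minc; apply/asboolP; exists g.
rewrite leq_eqVlt => /orP[/eqP cd|ltcd]; first by apply: lem; rewrite /= gd cd.
apply/ltW/ltlexP; exists k; last by rewrite mc gd ltz_nat.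
by move=> j ltji; apply: eqS => //; apply: sB.
Qed.

Lemma lex_coord_ge0 (i : nat) (ltin : (i < n)%N) g : (0 : Zlex n) <lex g ->
  (forall j : 'I_n, (j < i)%N -> g j = 0) -> 0 <= g (Ordinal ltin).
Proof.
move=> /ltlexP[k eqk]; rewrite ffunE => ltk g0.
have leik : (i <= k)%N.
  by rewrite leqNgt; apply/negP => /g0 gk0; rewrite gk0 ltxx in ltk.
move: leik; rewrite leq_eqVlt => /orP[/eqP ik|ltik].
  by rewrite (_ : Ordinal ltin = k) ?ltW //; apply: val_inj.
by rewrite -eqk // ffunE.
Qed.

Lemma mon_coord P (j : 'I_n) :
  (forall a, P a -> a j = 0) -> forall g, mon P g -> g j = 0.
Proof.
by move=> P0 g; elim=> [|a b Pa _ bj]; rewrite !ffunE // P0 // bj.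
Qed.

Lemma mon_coord_ge0 P (j : 'I_n) :
  (forall a, P a -> 0 <= a j) -> forall g, mon P g -> 0 <= g j.
Proof.
by move=> P0 g; elim=> [|a b Pa _ bj]; rewrite !ffunE // addr_ge0 // P0.
Qed.

(* Elements of P that vanish before coordinate i and are positive at i can
   occur at most c times in a sum whose i-th coordinate is c: [W c] collects
   such sums, and the induction is on the number of unconstrained coordinates. *)
Lemma wo_mon P : wo P -> (forall g, P g -> (0 : Zlex n) <lex g) -> wo (mon P).
Proof.
suff main d : (d <= n)%N -> forall P, wo P -> (forall g, P g -> (0 : Zlex n) <lex g) ->
    (forall g, P g -> forall j : 'I_n, (j < n - d)%N -> g j = 0) -> wo (mon P).
  by move=> woP posP; apply: (main n) => // g Pg j; rewrite subnn.
elim: d => [|d IH] led {}P woP posP P0.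
  apply: wo_sub wo0 => g; elim=> // a b Pa _ _.
  have := posP a Pa; have -> : a = 0; last by rewrite ltxx.
  by apply/ffunP => j; rewrite (P0 a) ?subn0 // ffunE.
set i := (n - d.+1)%N in P0.
have ltin : (i < n)%N by rewrite /i ltn_subrL (leq_trans _ led).
have iS : (n - d)%N = i.+1 by rewrite /i subnSK.
have Pge0 a : P a -> 0 <= a (Ordinal ltin).
  by move=> Pa; apply: lex_coord_ge0; [apply: posP|apply: P0].
apply: (wo_slices (ltin := ltin)).
- by move=> g h Mg Mh j ltji; rewrite !(@mon_coord P j) // => a /P0; apply.
- exact: mon_coord_ge0.
set k := Ordinal ltin in Pge0 *.
pose P0' : set (Zlex n) := [set g | P g /\ g k = 0].
have woP0 : wo (mon P0').
  apply: IH; first exact: ltnW.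
  - by apply: wo_sub woP => g [].
  - by move=> g [/posP].
  - move=> g [Pg gk0] j; rewrite iS ltnS leq_eqVlt => /orP[/eqP ji|ltji].
      by rewrite (_ : j = k) //; apply: val_inj.
    exact: P0.
pose W := fix W (c : nat) : set (Zlex n) :=
  if c is c'.+1 then W c' `|` addset P (W c') else mon P0'.
have woW c : wo (W c).
  by elim: c => //= c woc; apply: woU => //; apply: wo_add.
have W0 c : W c 0 by elim: c => [|c IHc] /=; [apply: mon0|left].
have WD a b c : P0' a -> W c b -> W c (a + b).
  move=> Pa; elim: c b => [|c IHc] b /=; first exact: monD.
  case=> [/IHc|[x [y [Px Wy ->]]]]; first by left.
  by right; exists x, (a + y); split=> //; [apply: IHc|rewrite addrCA].
have MW g : mon P g -> forall c : nat, g k <= c%:Z -> W c g.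
  elim=> [|a b Pa Mb IHb] c //; rewrite ffunE => lec.
  have [ak0|akN0] := eqVneq (a k) 0.
    by apply: WD => //; apply: IHb; rewrite ak0 add0r in lec.
  have ak1 : 1 <= a k by rewrite -gtz0_ge1 lt_neqAle eq_sym akN0 Pge0.
  have bk0 : 0 <= b k by apply: mon_coord_ge0 Mb.
  case: c lec => [|c] lec.
    by have := le_trans (lerD ak1 bk0) lec.
  right; exists a, b; split=> //; apply: IHb.
  have := le_trans (lerD ak1 (lexx (b k))) lec.
  by rewrite -[c.+1]addn1 PoszD [_ + 1]addrC lerD2l.
by move=> c; apply: wo_sub (woW c) => g [Mg gc]; apply: MW => //; rewrite gc.
Qed.

Definition nneg_exp : set (Zlex n) := [set g | forall i, 0 <= g i].

Lemma wo_nneg_exp : wo nneg_exp.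
Proof.
suff main d : (d <= n)%N -> forall S, (forall g, S g -> nneg_exp g) ->
    (forall g h, S g -> S h -> forall j : 'I_n, (j < n - d)%N -> g j = h j) ->
    wo S.
  by apply: (main n) => // g h _ _ j; rewrite subnn.
elim: d => [|d IH] led S posS eqS.
  move=> B sB [g Bg]; exists g => // h Bh.
  suff -> : h = g by [].
  by apply/ffunP => j; apply: eqS; rewrite ?subn0 //; apply: sB.
have ltin : (n - d.+1 < n)%N by rewrite ltn_subrL (leq_trans _ led).
apply: (wo_slices (ltin := ltin)) => //.
  by move=> g /posS; apply.
move=> c; apply: IH; [exact: ltnW|by move=> g [/posS]|].
move=> g h [Sg gc] [Sh hc] j; rewrite -subnSK // ltnS leq_eqVlt.
case/orP=> [/eqP ji|]; last exact: eqS.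
by rewrite (_ : j = Ordinal ltin) ?gc ?hc //; apply: val_inj.
Qed.

End LexOrder.

(* k((Z^n)): functions with well-ordered support. *)
Record hahn (k : fieldType) (n : nat) := Hahn {
  hcoef :> Zlex n -> k;
  hahn_wo_chain :
    wo_chain (fun g h : Zlex n => g <=lex h) [pred g | hcoef g != 0]
}.

HB.instance Definition _ k n := gen_eqMixin (hahn k n).
HB.instance Definition _ k n := gen_choiceMixin (hahn k n).

Section HahnRing.
Variables (k : fieldType) (n : nat).
Implicit Types (s p q : hahn k n) (g h a b : Zlex n).

Lemma hahnP s p : s =1 p -> s = p.
Proof.
case: s p => [s ws] [p wp] /= /funext sp; move: ws wp; rewrite sp => ws wp.
by congr Hahn; apply: Prop_irrelevance.
Qed.

Lemma hahn_wo s : wo [set g | s g != 0].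
Proof. by have /wo_chainP := @hahn_wo_chain k n s. Qed.
Arguments hahn_wo s : clear implicits.

Definition mk_hahn (f : Zlex n -> k) (wf : wo [set g | f g != 0]) : hahn k n :=
  Hahn (iffRL (wo_chainP [pred g | f g != 0]) wf).

(* The summand has finite support ([hterm_finite]), so this is the genuine
   sum and not the default value 0 of [\sum_(_ \in _)]. *)
Definition hconv (s p : Zlex n -> k) g : k :=
  \sum_(h \in [set: Zlex n]) s h * p (g - h).

Lemma hterm_finite s p g : finite_set [set h | s h * p (g - h) != 0].
Proof.
apply: sub_finite_set (conv_finite g (hahn_wo s) (hahn_wo p)) => h /=.
by rewrite mulf_eq0 negb_or => /andP.
Qed.

Lemma fsum_sub (F : Zlex n -> k) (A : set (Zlex n)) :
  (forall h, F h != 0 -> A h) ->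
  \sum_(h \in [set: Zlex n]) F h = \sum_(h \in A) F h.
Proof.
move=> FA; symmetry; apply: fsbig_widen => // h [_ nAh] /=.
by apply/eqP; apply: contrapT => /negP/FA.
Qed.

Lemma fsum_neq0 (F : Zlex n -> k) (A : set (Zlex n)) :
  \sum_(h \in A) F h != 0 -> exists2 h, A h & F h != 0.
Proof.
move=> nz; apply: contrapT => nF; move/negP: nz; apply; apply/eqP.
apply: fsbig1 => h Ah; apply/eqP; apply: contrapT => /negP Fh.
by apply: nF; exists h.
Qed.

Fact hzero_wo : wo [set g : Zlex n | (0 : k) != 0].
Proof. by apply: wo_sub (@wo0 n) => g /=; rewrite eqxx. Qed.
Definition hzero := mk_hahn hzero_wo.

Fact hone_wo : wo [set g : Zlex n | (g == 0)%:R != 0 :> k].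
Proof.
apply: wo_sub (@wo0 n) => g /=; have [-> //|_] := eqVneq g 0.
by rewrite eqxx.
Qed.
Definition hone := mk_hahn hone_wo.

Fact hopp_wo s : wo [set g | - s g != 0].
Proof. by apply: wo_sub (hahn_wo s) => g /=; rewrite oppr_eq0. Qed.
Arguments hopp_wo s : clear implicits.
Definition hopp s := mk_hahn (hopp_wo s).

Fact hadd_wo s p : wo [set g | s g + p g != 0].
Proof.
apply: wo_sub (woU (hahn_wo s) (hahn_wo p)) => g /=.
have [-> | sg _] := eqVneq (s g) 0; last by left.
by rewrite add0r; right.
Qed.
Arguments hadd_wo s p : clear implicits.
Definition hadd s p := mk_hahn (hadd_wo s p).

Fact hmul_wo s p : wo [set g | hconv s p g != 0].
Proof.
apply: wo_sub (wo_add (hahn_wo s) (hahn_wo p)) => g /= /fsum_neq0[h _].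
rewrite mulf_eq0 negb_or => /andP[sh ph].
by exists h, (g - h); split=> //; rewrite addrC addrNK.
Qed.
Arguments hmul_wo s p : clear implicits.
Definition hmul s p := mk_hahn (hmul_wo s p).

Fact haddA : associative hadd.
Proof. by move=> s p q; apply: hahnP => g /=; rewrite addrA. Qed.
Fact haddC : commutative hadd.
Proof. by move=> s p; apply: hahnP => g /=; rewrite addrC. Qed.
Fact hadd0 : left_id hzero hadd.
Proof. by move=> s; apply: hahnP => g /=; rewrite add0r. Qed.
Fact haddN : left_inverse hzero hopp hadd.
Proof. by move=> s; apply: hahnP => g /=; rewrite addNr. Qed.

HB.instance Definition _ :=
  GRing.isZmodule.Build (hahn k n) haddA haddC hadd0 haddN.

Fact hmulC : commutative hmul.
Proof.
move=> s p; apply: hahnP => g /=; rewrite /hconv.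
rewrite (reindex_fsbigT (fun h => g - h)) /=; last first.
  by exists (fun h => g - h) => h; rewrite opprB addrC addrNK.
by apply: eq_fsbigr => h _; rewrite mulrC opprB [g + _]addrC addrNK.
Qed.

Fact hmul1 : left_id hone hmul.
Proof.
move=> s; apply: hahnP => g /=; rewrite /hconv.
rewrite (@fsum_sub _ [set 0]) => [|h /=].
  by rewrite fsbig_set1 eqxx mul1r subr0.
by have [//|_] := eqVneq h 0; rewrite mul0r eqxx.
Qed.

Fact hmulDl : left_distributive hmul hadd.
Proof.
move=> s p q; apply: hahnP => g /=; rewrite /hconv.
pose A := [set h | s h * q (g - h) != 0] `|` [set h | p h * q (g - h) != 0].
have finA : finite_set A by rewrite finite_setU; split; apply: hterm_finite.
rewrite !(@fsum_sub _ A); first last.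
- move=> h nz; apply: contrapT => /not_orP[/negP + /negP].
  rewrite !negbK => /eqP s0 /eqP p0; move: nz.
  by rewrite mulrDl s0 p0 addr0 eqxx.
- by move=> h; left.
- by move=> h; right.
by rewrite -fsbig_split //; apply: eq_fsbigr => h _; rewrite mulrDl.
Qed.

Fact hmulA : associative hmul.
Proof.
move=> s p q; apply: hahnP => g /=; rewrite /hconv.
pose H := [set h | addset [set a | s a != 0] [set b | p b != 0] h /\ q (g - h) != 0].
have finH : finite_set H.
  exact: (conv_finite g (wo_add (hahn_wo s) (hahn_wo p)) (hahn_wo q)).
pose A := [set a | s a != 0 /\ addset [set b | p b != 0] [set c | q c != 0] (g - a)].
have finA : finite_set A.
  exact: (conv_finite g (hahn_wo s) (wo_add (hahn_wo p) (hahn_wo q))).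
rewrite (@fsum_sub _ A) => [|a]; last first.
  rewrite mulf_eq0 negb_or => /andP[sa /fsum_neq0[b _]].
  rewrite mulf_eq0 negb_or => /andP[pb qb].
  by split=> //; exists b, (g - a - b); split=> //; rewrite [RHS]addrC addrNK.
rewrite [RHS](@fsum_sub _ H) => [|h]; last first.
  rewrite mulf_eq0 negb_or => /andP[/fsum_neq0[a _]].
  rewrite mulf_eq0 negb_or => /andP[sa pa] qh.
  by split=> //; exists a, (h - a); split=> //; rewrite addrC addrNK.
transitivity (\sum_(a \in A) \sum_(h \in H) s a * p (h - a) * q (g - h)).
  apply: eq_fsbigr => a /set_mem[sa _].
  rewrite mulr_fsumr (reindex_fsbigT (fun h => h - a)) /=; last first.
    by exists (fun h => h + a) => h; rewrite ?addrNK ?addrK.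
  rewrite (@fsum_sub _ H) => [|h].
    apply: eq_fsbigr => h _; rewrite mulrA opprB addrA addrNK //.
  rewrite !mulf_eq0 !negb_or => /and3P[_ ph].
  rewrite opprB addrA addrNK => qh.
  by split=> //; exists a, (h - a); split=> //; rewrite addrC addrNK.
rewrite exchange_fsbig //; apply: eq_fsbigr => h /set_mem[_ qh].
rewrite mulr_fsuml; symmetry; apply: fsum_sub => a.
rewrite !mulf_eq0 !negb_or => /andP[/andP[sa pa] _]; split=> //.
by exists (h - a), (g - h); split=> //; rewrite [RHS]addrC addrA addrNK.
Qed.

Fact hone_neq0 : hone != 0 :> hahn k n.
Proof.
apply/eqP => /(congr1 (fun s : hahn k n => s 0)) /= /eqP.
by rewrite eqxx oner_eq0.
Qed.

HB.instance Definition _ := GRing.Zmodule_isComNzRing.Build (hahn k n)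
  hmulA hmulC hmul1 hmulDl hone_neq0.

Lemma hcoefM s p g :
  (s * p) g = \sum_(h \in [set: Zlex n]) s h * p (g - h).
Proof. by []. Qed.

Lemma hcoefD s p g : (s + p) g = s g + p g. Proof. by []. Qed.
Lemma hcoefN s g : (- s) g = - s g. Proof. by []. Qed.
Lemma hcoef0 g : (0 : hahn k n) g = 0. Proof. by []. Qed.
Lemma hcoef1 g : (1 : hahn k n) g = (g == 0)%:R. Proof. by []. Qed.

(* With g0 the least exponent of s and M the monoid generated by the g - g0,
   for g in the support of s, the inverse is supported in M - g0 and its
   coefficients are defined by well-founded recursion on M. *)
Lemma hahn_inv_ex s : s != 0 -> exists p, p * s = 1.
Proof.
move=> s0.
have [||g0 sg0 leg0] := hahn_wo s [set g | s g != 0] => //.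
  apply: contrapT => ns; move/eqP: s0; apply; apply: hahnP => g.
  by apply/eqP; apply: contrapT => /negP sg; apply: ns; exists g.
pose P : set (Zlex n) := [set a | s (g0 + a) != 0 /\ (0 : Zlex n) <lex a].
have woP : wo P.
  move=> B sBP [b Bb].
  have [||m Bm lem] := hahn_wo s ([set g | B (g - g0)]).
  - by move=> g /sBP[]; rewrite addrC addrNK.
  - by exists (b + g0); rewrite /= addrK.
  exists (m - g0) => // a Ba; rewrite -(lelexD2l g0) [g0 + (_ - _)]addrC addrNK.
  by apply: lem; rewrite /= addrC addKr.
pose M := mon P.
have woM : wo M by apply: wo_mon => // g [].
pose R a b := M a /\ a <lex b.
have wfR : well_founded R.
  have accM : forall a, M a -> Acc R a.
    apply: (wo_ind woM) => a Ma IH; constructor=> b [Mb ltb]; exact: IH.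
  by move=> a; constructor=> b [/accM].
pose body a (rec : forall b, R b a -> k) : k :=
  if `[< M a >] then
    (s g0)^-1 * ((a == 0)%:R - \sum_(h \in [set: Zlex n])
       (if pselect (R (a + g0 - h) a) is left Rb then s h * rec _ Rb else 0))
  else 0.
pose w := Fix wfR (fun _ => k) body.
have wE a : w a = body a (fun b _ => w b).
  rewrite /w Fix_eq // => x f f' ff'; congr (body x _).
  by apply: functional_extensionality_dep => y; apply: functional_extensionality_dep.
have wM a : w a != 0 -> M a.
  by rewrite wE /body; case: asboolP => //; rewrite eqxx.
have wo_p : wo [set a | w (a + g0) != 0].
  move=> B sB [b Bb].
  have [||m Bm lem] := woM [set a | B (a - g0)].
  - by move=> a /sB/=; rewrite addrNK => /wM.
  - by exists (b + g0); rewrite /= addrK.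
  exists (m - g0) => // a Ba; rewrite -(lelexD2l g0) [g0 + (_ - _)]addrC addrNK.
  by apply: lem; rewrite /= addrC addKr.
exists (mk_hahn wo_p); rewrite mulrC; apply: hahnP => a.
rewrite hcoefM hcoef1 /=.
under eq_fsbigr => h _ do rewrite addrAC.
have PM h : s h != 0 -> h != g0 -> P (h - g0).
  move=> sh hg0; split; first by rewrite addrC addrNK.
  by rewrite -(ltlexD2l g0) addr0 [g0 + _]addrC addrNK lt_neqAle eq_sym hg0 leg0.
have MP h : s h != 0 -> M (a + g0 - h) -> M a.
  move=> sh Mh; have [hg0|hg0] := eqVneq h g0.
    by move: Mh; rewrite hg0 addrK.
  rewrite (_ : a = (h - g0) + (a + g0 - h)); last first.
    by rewrite addrC addrA addrNK addrK.
  by apply: monD Mh; apply: PM.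
have fin : finite_set [set h | s h * w (a + g0 - h) != 0].
  apply: sub_finite_set (conv_finite (a + g0) (hahn_wo s) woM) => h /=.
  by rewrite mulf_eq0 negb_or => /andP[sh /wM].
have [Ma|nMa] := pselect (M a); last first.
  rewrite fsbig1 => [|h _].
    by have [a0|] := eqVneq a 0; [case: nMa; rewrite a0; apply: mon0|].
  apply/eqP; apply: contrapT => /negP; rewrite mulf_eq0 negb_or.
  by case/andP=> sh /wM /(MP h sh).
set F := fun h => s h * w (a + g0 - h).
rewrite -[LHS]/(\sum_(h \in setT) F h).
pose A := [set h | F h != 0] `|` [set g0].
rewrite (@fsum_sub F A) => [|h Fh]; last by left.
have finA : finite_set A by rewrite finite_setU; split; [|apply: finite_set1].
rewrite (fsbigD1 g0) //; last by right.
rewrite {1}/F addrK [w a]wE /body; case: asboolP => // _.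
rewrite mulrA mulfV // mul1r.
set X := \sum_(h \in setT) _.
suff -> : X = \sum_(h \in A `\ g0) F h by rewrite /= subrK.
rewrite {}/X (@fsum_sub _ (A `\ g0)).
  apply: eq_fsbigr => h /set_mem[Ah hg0].
  case: pselect => // nR; rewrite /F; apply/esym/eqP; apply: contrapT => /negP.
  rewrite mulf_eq0 negb_or => /andP[sh wh]; apply: nR; split; first exact: wM.
  have [|_] := PM h sh; first by apply/eqP.
  move=> lt0; rewrite -[X in _ <lex X]addr0 -addrA ltlexD2l.
  by rewrite -(ltlexD2l (h - g0)) addr0 -[g0 - h]opprB subrr.
move=> h; case: pselect => [[Mh lth]|]; last by rewrite eqxx.
move=> nz; split; first by left.
by move=> hg0; move: lth; rewrite hg0 addrK ltxx.
Qed.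

Definition hinv s : hahn k n :=
  if pselect (exists p, p * s = 1) is left ex then sval (cid ex) else 0.

Fact hmulVf s : s != 0 -> hinv s * s = 1.
Proof.
move=> s0; rewrite /hinv; case: pselect => [e|[]]; first exact: (svalP (cid e)).
exact: hahn_inv_ex.
Qed.

Fact hinv0 : hinv 0 = 0.
Proof.
rewrite /hinv; case: pselect => // e; have [p /eqP] := e.
by rewrite mulr0 eq_sym oner_eq0.
Qed.

HB.instance Definition _ :=
  GRing.ComNzRing_isField.Build (hahn k n) hmulVf hinv0.

End HahnRing.

(* Formal power series in n variables; the product is given by the formula of
   [mcoeffM], the one for polynomials. *)
Record fps (k : fieldType) (n : nat) := FPS { fpscoef :> 'X_{1..n} -> k }.

HB.instance Definition _ k n := gen_eqMixin (fps k n).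
HB.instance Definition _ k n := gen_choiceMixin (fps k n).

Section FpsRing.
Variables (k : fieldType) (n : nat).
Implicit Types (u v w : fps k n) (m : 'X_{1..n}).

Lemma fpsP u v : u =1 v -> u = v.
Proof. by case: u v => [u] [v] /= /funext ->. Qed.

Definition fps0 : fps k n := FPS (fun _ => 0).
Definition fps1 : fps k n := FPS (fun m => (m == 0%MM)%:R).
Definition fpsN u : fps k n := FPS (fun m => - u m).
Definition fpsD u v : fps k n := FPS (fun m => u m + v m).
Definition fpsM u v : fps k n := FPS (fun m =>
  \sum_(d : 'X_{1..n < (mdeg m).+1, (mdeg m).+1} | m == (d.1 + d.2)%MM)
     u d.1 * v d.2).

Fact fpsDA : associative fpsD.
Proof. by move=> u v w; apply: fpsP => m /=; rewrite addrA. Qed.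
Fact fpsDC : commutative fpsD.
Proof. by move=> u v; apply: fpsP => m /=; rewrite addrC. Qed.
Fact fpsD0 : left_id fps0 fpsD.
Proof. by move=> u; apply: fpsP => m /=; rewrite add0r. Qed.
Fact fpsDN : left_inverse fps0 fpsN fpsD.
Proof. by move=> u; apply: fpsP => m /=; rewrite addNr. Qed.

HB.instance Definition _ :=
  GRing.isZmodule.Build (fps k n) fpsDA fpsDC fpsD0 fpsDN.

Definition Zlex_of_mnm m : Zlex n := [ffun i => (m i)%:Z].

Lemma Zlex_of_mnm_inj : injective Zlex_of_mnm.
Proof.
move=> m m' /ffunP mm'; apply/mnmP => i.
by have := mm' i; rewrite !ffunE => -[].
Qed.

Lemma Zlex_of_mnmD m m' :
  Zlex_of_mnm (m + m')%MM = Zlex_of_mnm m + Zlex_of_mnm m'.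
Proof. by apply/ffunP => i; rewrite !ffunE mnmDE PoszD. Qed.

Lemma Zlex_of_mnm0 : Zlex_of_mnm 0%MM = 0.
Proof. by apply/ffunP => i; rewrite !ffunE mnm0E. Qed.

Definition mnm_of_Zlex (g : Zlex n) : 'X_{1..n} := [multinom `|g i|%N | i < n].

Lemma Zlex_of_mnmK : cancel Zlex_of_mnm mnm_of_Zlex.
Proof. by move=> m; apply/mnmP => i; rewrite mnmE ffunE. Qed.

Definition nnegb (g : Zlex n) : bool := [forall i, 0 <= g i].

Lemma mnm_of_ZlexK g : nnegb g -> Zlex_of_mnm (mnm_of_Zlex g) = g.
Proof. by move=> /forallP g0; apply/ffunP => i; rewrite ffunE mnmE gez0_abs. Qed.

Lemma nnegb_mnm m : nnegb (Zlex_of_mnm m).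
Proof. by apply/forallP => i; rewrite ffunE. Qed.

Lemma nnegbP g : reflect (exists m, g = Zlex_of_mnm m) (nnegb g).
Proof.
apply: (iffP idP) => [/mnm_of_ZlexK <-|[m ->]]; last exact: nnegb_mnm.
by exists (mnm_of_Zlex g).
Qed.

Fact hahn_of_fps_wo u :
  wo [set g | (if nnegb g then u (mnm_of_Zlex g) else 0) != 0].
Proof.
apply: wo_sub (@wo_nneg_exp n) => g /=; case: ifP => [/forallP //|_].
by rewrite eqxx.
Qed.
Arguments hahn_of_fps_wo u : clear implicits.

(* The embedding of k[[x]] in k((Z^n)): x^m is sent to t^m. *)
Definition hahn_of_fps u : hahn k n := mk_hahn (hahn_of_fps_wo u).

Lemma hahn_of_fpsE u m : hahn_of_fps u (Zlex_of_mnm m) = u m.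
Proof. by rewrite /= nnegb_mnm Zlex_of_mnmK. Qed.

Lemma hahn_of_fps_neq0 u g :
  hahn_of_fps u g != 0 -> exists2 m, g = Zlex_of_mnm m & u m != 0.
Proof.
rewrite /=; case: ifP => [|_]; last by rewrite eqxx.
by case/nnegbP=> m ->; rewrite Zlex_of_mnmK => um; exists m.
Qed.

Lemma hahn_of_fps_inj : injective hahn_of_fps.
Proof.
by move=> u v uv; apply: fpsP => m; rewrite -!hahn_of_fpsE uv.
Qed.

Lemma hahn_of_fpsB : {morph hahn_of_fps : u v / u - v}.
Proof.
move=> u v; apply: hahnP => g; rewrite hcoefD hcoefN /=.
by case: ifP => //; rewrite subr0.
Qed.

Lemma hahn_of_fps1 : hahn_of_fps fps1 = 1.
Proof.
apply: hahnP => g; rewrite hcoef1 /=; case: ifP => [/nnegbP[m ->]|].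
  by rewrite Zlex_of_mnmK -Zlex_of_mnm0 (inj_eq Zlex_of_mnm_inj).
by have [->|//] := eqVneq g 0; rewrite -Zlex_of_mnm0 nnegb_mnm.
Qed.

Lemma hahn_of_fpsM u v :
  hahn_of_fps (fpsM u v) = hahn_of_fps u * hahn_of_fps v.
Proof.
apply: hahnP => g; rewrite hcoefM.
have [|ng] := boolP (nnegb g); last first.
  rewrite fsbig1 /= ?(negPf ng) // => h _; apply/eqP.
  apply: contraNT ng; rewrite mulf_eq0 negb_or => /andP[].
  move=> /hahn_of_fps_neq0[a -> _] /hahn_of_fps_neq0[b gE _].
  by apply/nnegbP; exists (a + b)%MM; rewrite Zlex_of_mnmD -gE addrC addrNK.
case/nnegbP=> m ->; rewrite hahn_of_fpsE [LHS]/=.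
pose D : finType := 'X_{1..n < (mdeg m).+1, (mdeg m).+1}.
pose r := [seq d : D <- index_enum D | m == (d.1 + d.2)%MM].
pose f (d : D) := Zlex_of_mnm d.1.
have ur : uniq (map f r).
  rewrite map_inj_in_uniq ?filter_uniq ?index_enum_uniq // => -[d1 d2] [e1 e2].
  rewrite !mem_filter /= => /andP[/eqP md _] /andP[/eqP me _].
  rewrite /f /= => /Zlex_of_mnm_inj de; congr (_, _); apply: val_inj => //=.
  by apply: (@addmI _ d1); rewrite -md {1}me de.
transitivity (\sum_(d <- r) u d.1 * v d.2).
  by rewrite big_filter.
rewrite (@fsum_sub _ _ _ [set` map f r]) => [|h].
  rewrite -fsbig_seq // big_map big_filter [RHS]big_filter.
  apply: eq_bigr => d /eqP mE; rewrite /f.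
  have -> : Zlex_of_mnm m - Zlex_of_mnm d.1 = Zlex_of_mnm d.2.
    by rewrite [in LHS](congr1 Zlex_of_mnm mE) Zlex_of_mnmD addrAC subrr add0r.
  by rewrite -!hahn_of_fpsE.
rewrite mulf_eq0 negb_or => /andP[].
move=> /hahn_of_fps_neq0[a -> _] /hahn_of_fps_neq0[b gE _].
have mE : m = (a + b)%MM.
  by apply: Zlex_of_mnm_inj; rewrite Zlex_of_mnmD -gE addrC addrNK.
have lta : (mdeg a < (mdeg m).+1)%N by rewrite ltnS mE mdegD leq_addr.
have ltb : (mdeg b < (mdeg m).+1)%N by rewrite ltnS mE mdegD leq_addl.
apply/mapP; exists (BMultinom lta, BMultinom ltb) => //.
by rewrite mem_filter /= mem_index_enum -mE eqxx.
Qed.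

Fact fpsMA : associative fpsM.
Proof.
by move=> u v w; apply: hahn_of_fps_inj; rewrite !hahn_of_fpsM mulrA.
Qed.

Fact fpsMC : commutative fpsM.
Proof. by move=> u v; apply: hahn_of_fps_inj; rewrite !hahn_of_fpsM mulrC. Qed.

Fact fpsM1 : left_id fps1 fpsM.
Proof.
by move=> u; apply: hahn_of_fps_inj; rewrite hahn_of_fpsM hahn_of_fps1 mul1r.
Qed.

Fact hahn_of_fpsD : {morph hahn_of_fps : u v / u + v}.
Proof.
move=> u v; apply: hahnP => g; rewrite hcoefD /=.
by case: ifP => //; rewrite addr0.
Qed.

Fact fpsMDl : left_distributive fpsM fpsD.
Proof.
move=> u v w; apply: hahn_of_fps_inj.
by rewrite hahn_of_fpsD !hahn_of_fpsM hahn_of_fpsD mulrDl.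
Qed.

Fact fps1_neq0 : fps1 != 0 :> fps k n.
Proof.
apply/eqP => /(congr1 (fun u : fps k n => u 0%MM)) /= /eqP.
by rewrite eqxx oner_eq0.
Qed.

HB.instance Definition _ := GRing.Zmodule_isComNzRing.Build (fps k n)
  fpsMA fpsMC fpsM1 fpsMDl fps1_neq0.

HB.instance Definition _ := GRing.isZmodMorphism.Build (fps k n) (hahn k n)
  hahn_of_fps hahn_of_fpsB.
HB.instance Definition _ := GRing.isMonoidMorphism.Build (fps k n) (hahn k n)
  hahn_of_fps (hahn_of_fps1, hahn_of_fpsM).

Definition fps_unit : {pred fps k n} := [pred u | `[< exists v, v * u = 1 >]].
Definition fps_inv u : fps k n :=
  if pselect (exists v, v * u = 1) is left ex then sval (cid ex) else u.

Fact fps_mulVr : {in fps_unit, left_inverse 1 fps_inv *%R}.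
Proof.
move=> u /asboolP uu; rewrite /fps_inv; case: pselect => // e.
exact: (svalP (cid e)).
Qed.

Fact fps_unitP u v : v * u = 1 -> fps_unit u.
Proof. by move=> vu; apply/asboolP; exists v. Qed.

Fact fps_inv_out : {in [predC fps_unit], fps_inv =1 id}.
Proof.
by move=> u /asboolPn nu; rewrite /fps_inv; case: pselect => // /nu.
Qed.

HB.instance Definition _ := GRing.ComNzRing_hasMulInverse.Build (fps k n)
  fps_mulVr fps_unitP fps_inv_out.

Fact fps_integral u v : u * v = 0 -> (u == 0) || (v == 0).
Proof.
move=> uv; rewrite -!(inj_eq hahn_of_fps_inj) raddf0 -mulf_eq0.
by rewrite -[X in X == 0]rmorphM uv raddf0.
Qed.

HB.instance Definition _ :=
  GRing.ComUnitRing_isIntegral.Build (fps k n) fps_integral.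

(* The inclusion of k[x] in k[[x]]. *)
Definition fps_of_mpoly (p : {mpoly k[n]}) : fps k n := FPS (fun m => p@_m).

Lemma fps_of_mpoly_inj : injective fps_of_mpoly.
Proof.
by move=> p q pq; apply/mpolyP => m; have /(congr1 (fun u : fps k n => u m)) := pq.
Qed.

Fact fps_of_mpolyB : {morph fps_of_mpoly : p q / p - q}.
Proof. by move=> p q; apply: fpsP => m /=; rewrite mcoeffB. Qed.

Fact fps_of_mpoly_monoid : monoid_morphism fps_of_mpoly.
Proof.
split=> [|p q]; apply: fpsP => m; first by rewrite /= mcoeff1.
exact: mcoeffM.
Qed.

HB.instance Definition _ := GRing.isZmodMorphism.Build {mpoly k[n]} (fps k n)
  fps_of_mpoly fps_of_mpolyB.
HB.instance Definition _ := GRing.isMonoidMorphism.Build {mpoly k[n]} (fps k n)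
  fps_of_mpoly fps_of_mpoly_monoid.

End FpsRing.

Lemma frac_reprE (R : idomainType) (x : {fraction R}) :
  x = tofrac \n_(repr x) / tofrac \d_(repr x).
Proof.
apply: (canRL (mulfK _)); first by rewrite tofrac_eq0 denom_ratioP.
have := denom_ratioP (repr x); rewrite -{2}[x]reprK; move: (repr x) => r d0.
unlock FracField.tofrac; rewrite -[LHS]FracField.pi_mul; apply/eqmodP.
rewrite /= FracField.equivfE /FracField.mulf.
by rewrite !numden_Ratio ?oner_eq0 ?mulr1 ?mulf_neq0 // mulrC.
Qed.

(* The unique extension of an injective morphism to the fraction field.
   Injectivity is not used in the formula; it is an argument so that the
   morphism structure below can be attached to it. *)
Section FracLift.
Variables (R : idomainType) (F : fieldType) (phi : {rmorphism R -> F}).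
Hypothesis phi_inj : injective phi.

Definition frac_lift of injective phi := fun x : {fraction R} =>
  phi \n_(repr x) / phi \d_(repr x).
Local Notation lift := (frac_lift phi_inj).

Let phi_neq0 c : c != 0 -> phi c != 0.
Proof. by move=> c0; rewrite -(rmorph0 phi) (inj_eq phi_inj). Qed.

Lemma frac_lift_div (a b : R) : b != 0 ->
  lift (tofrac a / tofrac b) = phi a / phi b.
Proof.
move=> b0; rewrite /frac_lift.
have := frac_reprE (tofrac a / tofrac b).
have := denom_ratioP (repr (tofrac a / tofrac b)).
move: \n_(_) \d_(_) => c d d0 /eqP.
rewrite eqr_div ?tofrac_eq0 // -!tofracM tofrac_eq => /eqP abcd.
by apply/eqP; rewrite eqr_div ?phi_neq0 // -!rmorphM -abcd.
Qed.

Lemma frac_lift_tofrac a : lift (tofrac a) = phi a.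
Proof.
by rewrite -[tofrac a]divr1 -tofrac1 frac_lift_div ?oner_eq0 // rmorph1 divr1.
Qed.

Lemma fracP (x : {fraction R}) :
  exists a b, b != 0 /\ x = tofrac a / tofrac b.
Proof.
exists \n_(repr x), \d_(repr x).
by split; [apply: denom_ratioP|apply: frac_reprE].
Qed.

Fact frac_liftB : {morph lift : x y / x - y}.
Proof.
move=> x y; have [a [b [b0 ->]]] := fracP x; have [c [d [d0 ->]]] := fracP y.
rewrite -mulNr -tofracN addf_div ?tofrac_eq0 // -!tofracM -tofracD.
rewrite !frac_lift_div ?mulf_neq0 // rmorphD !rmorphM rmorphN.
by rewrite -addf_div ?phi_neq0 // mulNr.
Qed.

Fact frac_lift_monoid : monoid_morphism lift.
Proof.
split; first by rewrite -tofrac1 frac_lift_tofrac rmorph1.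
move=> x y; have [a [b [b0 ->]]] := fracP x; have [c [d [d0 ->]]] := fracP y.
rewrite mulf_div -!tofracM !frac_lift_div ?mulf_neq0 // !rmorphM.
by rewrite mulf_div.
Qed.

HB.instance Definition _ :=
  GRing.isZmodMorphism.Build {fraction R} F lift frac_liftB.
HB.instance Definition _ :=
  GRing.isMonoidMorphism.Build {fraction R} F lift frac_lift_monoid.

End FracLift.

Section Expansion.
Variables (k : fieldType) (n : nat).

(* The embedding of k((x)) in k((Z^n)): [series_expansion s g] is the
   coefficient of x^g in the expansion of s. *)
Definition series_expansion : {fraction fps k n} -> hahn k n :=
  frac_lift (@hahn_of_fps_inj k n).

Lemma tofrac_fps_of_mpoly_inj :
  injective (@tofrac (fps k n) \o @fps_of_mpoly k n).
Proof.
by move=> p q /= /eqP; rewrite tofrac_eq => /eqP/fps_of_mpoly_inj.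
Qed.

(* The inclusion of k(x) in k((x)). *)
Definition series_of_ratfun : {fraction {mpoly k[n]}} -> {fraction fps k n} :=
  frac_lift tofrac_fps_of_mpoly_inj.

HB.instance Definition _ := GRing.RMorphism.on series_expansion.
HB.instance Definition _ := GRing.RMorphism.on series_of_ratfun.

Lemma series_expansion_tofrac (u : fps k n) :
  series_expansion (tofrac u) = hahn_of_fps u.
Proof. exact: frac_lift_tofrac. Qed.

Lemma series_of_ratfun_tofrac (p : {mpoly k[n]}) :
  series_of_ratfun (tofrac p) = tofrac (fps_of_mpoly p).
Proof. exact: frac_lift_tofrac. Qed.

End Expansion.

(* Main.v *)
(* The recurrence says exactly that multiplying s by the Laurent polynomial
   \sum_j r_j t^(h_j) gives a series supported in A, i.e. another Laurent
   polynomial; multiplying both by a large monomial turns them into ordinary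
   polynomials. Conversely, for s = p / q take for A the union of the supports
   of p and q, and for the r_j the coefficients of q on A. *)

From HB Require Import structures.
Require Import Defs.
From mathcomp Require Import all_boot all_order all_algebra.
From mathcomp Require Import boolp classical_sets functions cardinality fsbigop.
From mathcomp Require Import mpoly.

Set Implicit Arguments.
Unset Strict Implicit.
Unset Printing Implicit Defensive.

Import Order.TTheory GRing.Theory Num.Theory.
Local Open Scope ring_scope.

Section HahnOfMpoly.
Variables (k : fieldType) (n : nat).
Implicit Types (s : hahn k n) (p q : {mpoly k[n]}) (g : Zlex n).

(** Mapping polynomials straight into the field [hahn k n] lets both directions be argued there,
    away from the fraction fields. *)
Definition hahn_of_mpoly p : hahn k n := hahn_of_fps (fps_of_mpoly p).

HB.instance Definition _ := GRing.RMorphism.copy hahn_of_mpoly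
  (@hahn_of_fps k n \o @fps_of_mpoly k n).

Lemma hahn_of_mpolyE p m : hahn_of_mpoly p (Zlex_of_mnm m) = p@_m.
Proof. exact: hahn_of_fpsE. Qed.

Lemma hahn_of_mpoly_neq0 p g :
  hahn_of_mpoly p g != 0 -> exists2 m, m \in msupp p & g = Zlex_of_mnm m.
Proof.
by move=> /hahn_of_fps_neq0[m -> pm]; exists m; rewrite ?mcoeff_msupp.
Qed.

Lemma hahn_of_mpoly_inj : injective hahn_of_mpoly.
Proof. by move=> p q /hahn_of_fps_inj/fps_of_mpoly_inj. Qed.

Lemma hahn_of_mpoly_eq0 p : (hahn_of_mpoly p == 0) = (p == 0).
Proof. by rewrite -(inj_eq hahn_of_mpoly_inj) raddf0. Qed.

(** The list [e] may exceed the support of [s]: the extra terms vanish. So one list can serve two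
    series at once. *)
Lemma hcoefM_seq s s' (e : seq (Zlex n)) g : uniq e ->
  (forall h, s h != 0 -> h \in e) ->
  (s * s') g = \sum_(h <- e) s h * s' (g - h).
Proof.
move=> ue se; rewrite hcoefM (@fsum_sub _ _ _ [set` e]%classic) => [|h].
  by rewrite -fsbig_seq.
by rewrite mulf_eq0 negb_or => /andP[/se].
Qed.

Lemma hcoef_sum (I : Type) (r : seq I) (F : I -> hahn k n) g :
  (\sum_(i <- r) F i) g = \sum_(i <- r) F i g.
Proof.
by elim/big_ind2: _ => // ? ? ? ? <- <-; rewrite hcoefD.
Qed.

Lemma hcoef_monomM (c : k) m s g :
  (hahn_of_mpoly (c *: 'X_[m]) * s) g = c * s (g - Zlex_of_mnm m).
Proof.
rewrite (@hcoefM_seq _ _ [:: Zlex_of_mnm m]) // => [|h].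
  by rewrite big_seq1 hahn_of_mpolyE mcoeffZ mcoeffX eqxx mulr1.
case/hahn_of_mpoly_neq0=> m' + ->; rewrite mcoeff_msupp mcoeffZ mcoeffX.
by case: (eqVneq m m') => [->|_]; rewrite ?inE // mulr0 eqxx.
Qed.

(** This identifies the left-hand side of a recurrence with nonnegative shifts as a coefficient of a
    product. *)
Lemma hcoef_mpolyM (I : Type) (e : seq I) (c : I -> k) (m : I -> 'X_{1..n}) s g :
  (hahn_of_mpoly (\sum_(i <- e) c i *: 'X_[m i]) * s) g =
  \sum_(i <- e) c i * s (g - Zlex_of_mnm (m i)).
Proof.
rewrite rmorph_sum mulr_suml hcoef_sum; apply: eq_bigr => i _.
exact: hcoef_monomM.
Qed.

Lemma series_expansion_ratfun p q : q != 0 ->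
  series_expansion (series_of_ratfun (tofrac p / tofrac q)) =
  hahn_of_mpoly p / hahn_of_mpoly q.
Proof.
move=> q0; rewrite /series_of_ratfun frac_lift_div //=.
by rewrite /series_expansion frac_lift_div // raddf_eq0 //; apply: fps_of_mpoly_inj.
Qed.

(** The recurrence at [g] computes the coefficient of $qs = p$ at [g], which is zero when [g] is
    outside the support of [p]. *)
Lemma ratfun_annihilated s p q : q != 0 -> hahn_of_mpoly q * s = hahn_of_mpoly p ->
  exists (l : nat) (h : 'I_l.+1 -> Zlex n) (r : 'I_l.+1 -> k),
    [/\ forall i j : 'I_l.+1, (i < j)%N -> h i <lex h j,
        exists j : 'I_l.+1, r j != 0
      & forall g : Zlex n, g \notin codom h ->
          \sum_(j < l.+1) r j * s (g - h j) = 0].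
Proof.
move=> q0 qsp.
pose e := sort <=%O (undup (map (@Zlex_of_mnm n) (msupp p ++ msupp q))).
have ue : uniq e by rewrite sort_uniq undup_uniq.
have mem_e m : m \in msupp p ++ msupp q -> Zlex_of_mnm m \in e.
  by move=> mpq; rewrite mem_sort mem_undup map_f.
have pe g : hahn_of_mpoly p g != 0 -> g \in e.
  by case/hahn_of_mpoly_neq0=> m pm ->; rewrite mem_e // mem_cat pm.
have qe g : hahn_of_mpoly q g != 0 -> g \in e.
  by case/hahn_of_mpoly_neq0=> m qm ->; rewrite mem_e // mem_cat qm orbT.
(* The leading exponent of [q] serves twice: it makes [e] nonempty, so that its size is some [l.+1],
   and it provides a nonzero [r j]. *)
have [g0 g0e qg0] : exists2 g, g \in e & hahn_of_mpoly q g != 0.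
  exists (Zlex_of_mnm (mlead q)); last first.
    by rewrite hahn_of_mpolyE -mcoeff_msupp mlead_supp.
  by apply: qe; rewrite hahn_of_mpolyE -mcoeff_msupp mlead_supp.
case el : (size e) => [|l]; first by rewrite (size0nil el) in g0e.
exists l, (fun j => nth 0 e j), (fun j => hahn_of_mpoly q (nth 0 e j)); split.
- move=> i j ltij; apply: (sorted_ltn_nth lt_trans); rewrite ?inE ?el //.
  by rewrite sort_lt_sorted undup_uniq.
- have lt0 : (index g0 e < l.+1)%N by rewrite -el index_mem.
  by exists (Ordinal lt0); rewrite nth_index.
move=> g ge.
transitivity ((hahn_of_mpoly q * s) g); last first.
  rewrite qsp; apply/eqP; apply: contraNT ge => /pe ge.
  have lt0 : (index g e < l.+1)%N by rewrite -el index_mem.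
  by apply/codomP; exists (Ordinal lt0); rewrite nth_index.
by rewrite (hcoefM_seq _ _ ue qe) [RHS](big_nth 0) el big_mkord.
Qed.

Lemma annihilated_ratfun s (l : nat) (h : 'I_l.+1 -> Zlex n) (r : 'I_l.+1 -> k) :
  injective h -> (exists j, r j != 0) ->
  (forall g, g \notin codom h -> \sum_(j < l.+1) r j * s (g - h j) = 0) ->
  exists p q, q != 0 /\ hahn_of_mpoly q * s = hahn_of_mpoly p.
Proof.
move=> injh [j0 rj0] rec0.
(* x^M clears the negative exponents of every h j. *)
pose M : Zlex n := [ffun i => (\sum_(j < l.+1) `|h j i|%N)%N%:Z].
pose m j := mnm_of_Zlex (h j + M).
have mE j : Zlex_of_mnm (m j) = h j + M.
  apply: mnm_of_ZlexK; apply/forallP => i; rewrite !ffunE.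
  rewrite (bigD1 j) //= PoszD addrA addr_ge0 // abszE -lerBlDl sub0r.
  by rewrite -normrN ler_norm.
(* The values of the recurrence on $A$, where it may fail to vanish; they become the coefficients of
   the numerator. *)
pose c j := \sum_(i < l.+1) r i * s (h j - h i).
have shift g j : g - Zlex_of_mnm (m j) = (g - M) - h j.
  by rewrite mE opprD addrA addrAC.
exists (\sum_(j < l.+1) c j *: 'X_[m j]), (\sum_(j < l.+1) r j *: 'X_[m j]).
(* Multiplying by the series 1 makes [hcoef_mpolyM] read off the coefficients of the polynomial
   itself. *)
have coef (d : 'I_l.+1 -> k) g :
    hahn_of_mpoly (\sum_(j < l.+1) d j *: 'X_[m j]) g
      = \sum_(j < l.+1) d j * (g - M == h j)%:R.
  rewrite -[hahn_of_mpoly _]mulr1 hcoef_mpolyM; apply: eq_bigr => j _.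
  by rewrite shift hcoef1 subr_eq0.
have coefh (d : 'I_l.+1 -> k) j :
    \sum_(i < l.+1) d i * (h j == h i)%:R = d j.
  rewrite (bigD1 j) //= eqxx mulr1 big1 ?addr0 // => i ij.
  by rewrite (inj_eq injh) eq_sym (negPf ij) mulr0.
split.
  apply: contraNneq rj0 => q0; have := coef r (h j0 + M).
  by rewrite q0 raddf0 hcoef0 addrK coefh => <-.
apply: hahnP => g; rewrite hcoef_mpolyM coef.
under eq_bigr => j _ do rewrite shift.
(* Where [g - M] is some [h j], both sides equal [c j]; elsewhere the left side vanishes by the
   recurrence and the right side has no monomial. *)
have [/codomP[j ->]|nh] := boolP (g - M \in codom h); first by rewrite coefh.
rewrite rec0 // big1 // => j _; case: eqP => [gh|_]; last by rewrite mulr0.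
by rewrite gh codom_f in nh.
Qed.

End HahnOfMpoly.

Theorem corollary7p3 (k : fieldType) (n : nat) (n_gt0 : (0 < n)%N)
    (s : {fraction fps k n}) :
  (exists f : {fraction {mpoly k[n]}}, s = series_of_ratfun f) <->
  (exists (l : nat) (h : 'I_l.+1 -> Zlex n) (r : 'I_l.+1 -> k),
    [/\ forall i j : 'I_l.+1, (i < j)%N -> h i <lex h j,
        exists j : 'I_l.+1, r j != 0
      & forall g : Zlex n, g \notin codom h ->
          \sum_(j < l.+1) r j * series_expansion s (g - h j) = 0]).
Proof.
split=> [[f ->]|[l [h [r [lth r0 rec0]]]]].
  have [p [q [q0 ->]]] := fracP f.
  apply: (ratfun_annihilated (p := p) q0).
  by rewrite series_expansion_ratfun // mulrC divfK ?hahn_of_mpoly_eq0.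
have injh : injective h.
  move=> i j hij; apply: val_inj.
  by case: (ltngtP i j) => // /lth; rewrite hij ltxx.
have [p [q [q0 qsp]]] := annihilated_ratfun injh r0 rec0.
(* As a morphism of fields, the expansion is injective, so the equality in $k((\underline{x}))$ can
   be checked in $k((\mathbb{Z}^n))$. *)
exists (tofrac p / tofrac q); apply: (fmorph_inj (@series_expansion k n)).
by rewrite /= series_expansion_ratfun // -qsp mulrC mulKf ?hahn_of_mpoly_eq0.
Qed.
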